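(* Let $K\subset\mathbb{R}^n$ be a convex body and let $j\in\{0,\ldots,n\}$. Then $$1\le \alpha_j(K)\le \min\left\{n,\ \frac{\alpha_0(K)+1}{2}\sqrt{n}\right\},$$ and $\alpha_j(K)=1$ if and only if there exists a $j$-dimensional affine subspace $U\subset\mathbb{R}^n$ such that $K=\Phi_U(K)$.
   Context: A convex body in $\mathbb{R}^n$ is a compact convex set with nonempty interior. For an affine subspace $U\subset\mathbb{R}^n$, $P_U$ denotes the orthogonal (nearest-point) projection onto $U$ and $\Phi_U(x)=2P_U(x)-x$ is the reflection across $U$. For convex bodies $K,C\subset\mathbb{R}^n$, the circumradius of $K$ with respect to $C$ is $R(K,C)=\inf\{\lambda>0 : K\subset z+\lambda C\text{ for some }z\in\mathbb{R}^n\}$. The $j$th Minkowski chirality of $K$ is $\alpha_j(K)=\inf\{R(K,\Phi_U(K)) : U\subset\mathbb{R}^n\text{ affine subspace},\ \dim U=j\}$. In particular $\alpha_0(K)$ is the Minkowski asymmetry, i.e. $\alpha_0(K)=R(K,-K)$. *)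

(* Defs.v *)
From HB Require Import structures.
From mathcomp Require Import all_boot all_order all_algebra.
From mathcomp Require Import all_classical all_reals all_analysis.

Set Implicit Arguments.
Unset Strict Implicit.
Unset Printing Implicit Defensive.

Import Order.TTheory GRing.Theory Num.Theory.
Import numFieldNormedType.Exports.

Local Open Scope classical_set_scope.
Local Open Scope ring_scope.

(* R^n is 'rV[R]_n. Its library norm `|x| is the sup norm: it induces the usual
   topology (used for compact and interior), but projections need enorm. *)

Definition enorm (R : realType) (n : nat) (x : 'rV[R]_n) : R :=
  Num.sqrt (\sum_(i < n) x 0 i ^+ 2).

Definition convex_body (R : realType) (n : nat) (K : set 'rV[R]_n) : Prop :=
  [/\ compact K, convex_set (M := 'rV[R]_n) K & interior K !=set0].

Definition affine_subspace (R : realType) (n j : nat) (U : set 'rV[R]_n) :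
    Prop :=
  exists (p : 'rV[R]_n) (V : {vspace 'rV[R]_n}),
    \dim V = j /\ U = [set p + v | v in [set v | v \in V]].

(* Nearest points of an affine subspace exist and are unique, so the value of
   get is meaningful there. *)
Definition proj (R : realType) (n : nat) (U : set 'rV[R]_n) (x : 'rV[R]_n) :
    'rV[R]_n :=
  get [set y | U y /\ forall z, U z -> enorm (x - y) <= enorm (x - z)].

Definition reflection (R : realType) (n : nat) (U : set 'rV[R]_n)
    (x : 'rV[R]_n) : 'rV[R]_n :=
  2 *: proj U x - x.

(* The infima below are taken in R, where inf set0 = 0; for convex bodies and
   j <= n both sets are nonempty and bounded below by 0. *)
Definition circumradius (R : realType) (n : nat) (K C : set 'rV[R]_n) : R :=
  inf [set l : R | 0 < l /\
    exists z : 'rV[R]_n, K `<=` [set z + l *: c | c in C]].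

Definition chirality (R : realType) (n j : nat) (K : set 'rV[R]_n) : R :=
  inf [set circumradius K (reflection U @` K) |
        U in [set U | affine_subspace j U]].

(* Main.v *)
(** Let [y = xA - z] map the minimal-volume ellipsoid enclosing [K] to the unit
    ball. Minimality forces [n a b >= 1] whenever [-b <= <y, e> <= a] on [K] for a
    unit vector [e], since otherwise an explicit smaller ellipsoid contains that
    slab of the ball. Taking [b = 1] and separating points from [K] gives the
    concentric inner ellipsoid of ratio [n]. If [-K] lies in [sK + t], one may take
    [b = s a + tau] with [tau] linear in [e]; then [n a (s a + tau) >= 1] gives
    [a >= - tau / (2 s) + 1 / sqrt (s n)], an inner ellipsoid of ratio [sqrt (s n)],
    which is at most [(s + 1) / 2 * sqrt n]. Reflecting in a [j]-dimensional
    subspace invariant for [A A^T] preserves the ellipsoid, so these ratios bound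
    the chirality.

    The lower bound [1] compares diameters. If it is an equality, compactness gives
    an orthogonal reflection followed by a translation that maps [K] into itself;
    its square is a translation, hence the identity, so it is the reflection in an
    affine subspace and maps [K] onto itself. *)

Require Import Defs.
From mathcomp Require Import all_boot all_order all_algebra.
From mathcomp Require Import all_classical all_reals all_analysis.
From mathcomp Require Import perm ring lra.

Import Order.TTheory GRing.Theory Num.Theory.
Import numFieldNormedType.Exports.

Local Open Scope classical_set_scope.
Local Open Scope ring_scope.

(** * Euclidean structure and orthogonal projections *)

Definition dot {R : realType} {n : nat} (u v : 'rV[R]_n) : R :=
  (u *m v^T) 0 0.

Definition sqn {R : realType} {n : nat} (u : 'rV[R]_n) : R := dot u u.

Section InnerProduct.
Context {R : realType} {n : nat}.
Implicit Types (u v w : 'rV[R]_n) (A : 'M[R]_n) (a : R).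

Lemma dotE u v : dot u v = \sum_(i < n) u 0 i * v 0 i.
Proof. by rewrite /dot mxE; apply: eq_bigr => i _; rewrite mxE. Qed.

Lemma dotC u v : dot u v = dot v u.
Proof. by rewrite !dotE; apply: eq_bigr => i _; rewrite mulrC. Qed.

Lemma dotDl u v w : dot (u + v) w = dot u w + dot v w.
Proof. by rewrite /dot mulmxDl mxE. Qed.

Lemma dotDr u v w : dot u (v + w) = dot u v + dot u w.
Proof. by rewrite dotC dotDl !(dotC u). Qed.

Lemma dotZl a u v : dot (a *: u) v = a * dot u v.
Proof. by rewrite /dot -scalemxAl mxE. Qed.

Lemma dotZr a u v : dot u (a *: v) = a * dot u v.
Proof. by rewrite dotC dotZl dotC. Qed.

Lemma dotNl u v : dot (- u) v = - dot u v.
Proof. by rewrite -scaleN1r dotZl mulN1r. Qed.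

Lemma dotNr u v : dot u (- v) = - dot u v.
Proof. by rewrite dotC dotNl dotC. Qed.

Lemma dot_mulmxl u v A : dot (u *m A) v = dot u (v *m A^T).
Proof. by rewrite /dot trmx_mul trmxK mulmxA. Qed.

Lemma dot_delta_row u j : dot u (delta_mx 0 j) = u 0 j.
Proof.
rewrite dotE (bigD1 j)//= big1 ?addr0 ?mxE ?eqxx ?mulr1// => i ij.
by rewrite mxE eqxx (negbTE ij) mulr0.
Qed.

Definition dot_lin := (dotDl, dotDr, dotNl, dotNr, dotZl, dotZr).

Lemma sqnE u : sqn u = \sum_(i < n) u 0 i ^+ 2.
Proof. by rewrite /sqn dotE; apply: eq_bigr => i _; rewrite expr2. Qed.

Lemma enormE u : enorm u = Num.sqrt (sqn u).
Proof. by rewrite /enorm sqnE. Qed.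

Lemma sqn_ge0 u : 0 <= sqn u.
Proof. by rewrite sqnE; apply: sumr_ge0 => i _; rewrite sqr_ge0. Qed.

Lemma sqn_eq0 u : (sqn u == 0) = (u == 0).
Proof.
apply/idP/eqP => [|->]; last first.
  by rewrite sqnE big1// => i _; rewrite mxE expr0n.
rewrite sqnE psumr_eq0 => [/allP u0|i _]; last exact: sqr_ge0.
apply/rowP => i; rewrite mxE; apply/eqP.
by have := u0 i (mem_index_enum _); rewrite sqrf_eq0.
Qed.

Lemma sqn_gt0 u : (0 < sqn u) = (u != 0).
Proof. by rewrite lt_neqAle sqn_ge0 andbT eq_sym sqn_eq0. Qed.

Lemma sqnD u v : sqn (u + v) = sqn u + 2 * dot u v + sqn v.
Proof. by rewrite /sqn !dot_lin (dotC v u); ring. Qed.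

Lemma sqnN u : sqn (- u) = sqn u.
Proof. by rewrite /sqn !dot_lin opprK. Qed.

Lemma sqnZ a u : sqn (a *: u) = a ^+ 2 * sqn u.
Proof. by rewrite /sqn !dot_lin; ring. Qed.

Lemma cauchy_schwarz u v : dot u v ^+ 2 <= sqn u * sqn v.
Proof.
have [->|v0] := eqVneq v 0.
  by rewrite /sqn /dot !trmx0 !mulmx0 mxE expr0n/= mulr0.
have v_gt0 : 0 < sqn v by rewrite sqn_gt0.
have := sqn_ge0 (sqn v *: u - dot u v *: v).
have -> : sqn (sqn v *: u - dot u v *: v) =
    sqn v * (sqn u * sqn v - dot u v ^+ 2).
  by rewrite /sqn !dot_lin (dotC v u); ring.
by rewrite pmulr_rge0// subr_ge0.
Qed.

Lemma dot_le u v a : 0 <= a -> sqn u <= a ^+ 2 -> sqn v = 1 -> dot u v <= a.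
Proof.
move=> a0 ua v1; apply: le_trans (ler_norm _) _.
rewrite -(ler_pXn2r (n := 2)) ?nnegrE// real_normK ?num_real//.
by apply: le_trans ua; rewrite -[leRHS]mulr1 -v1 cauchy_schwarz.
Qed.

Lemma sqr_entry_le u i : u 0 i ^+ 2 <= sqn u.
Proof.
rewrite sqnE (bigD1 i)//= lerDl.
by apply: sumr_ge0 => k _; rewrite sqr_ge0.
Qed.

Lemma entry_le_sqn u i a : 0 <= a -> sqn u <= a ^+ 2 -> `|u 0 i| <= a.
Proof.
move=> a0 ua; rewrite -(ler_pXn2r (n := 2)) ?nnegrE// real_normK ?num_real//.
exact: le_trans (sqr_entry_le u i) ua.
Qed.

Lemma sqn_isometry A : A *m A^T = 1%:M -> forall u, sqn (u *m A) = sqn u.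
Proof.
by move=> AA u; rewrite /sqn dot_mulmxl -mulmxA AA mulmx1.
Qed.

Lemma exists_unit_vector : (0 < n)%N -> exists e : 'rV[R]_n, sqn e = 1.
Proof.
by move=> n0; exists (delta_mx 0 (Ordinal n0));
  rewrite /sqn dot_delta_row mxE !eqxx.
Qed.

End InnerProduct.

(** Two block-triangular factorizations of one bordered matrix are compared. The formula measures
    the volume change of the stretch along [e] in [loewner_slab]. *)
Lemma det_rank_one (R : comPzRingType) n (u : 'cV[R]_n) (v : 'rV[R]_n) :
  \det (1%:M + u *m v) = 1 + (v *m u) 0 0 :> R.
Proof.
have E1 : block_mx (1%:M : 'M[R]_n) u (- v) (1%:M : 'M[R]_1) =
    block_mx 1%:M 0 (- v) 1%:M *m block_mx 1%:M u 0 (1%:M + v *m u).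
  rewrite mulmx_block !(mulmx1, mul1mx, mul0mx, mulmx0, addr0, add0r) mulNmx.
  by rewrite addrCA addNr addr0.
have E2 : block_mx (1%:M : 'M[R]_n) u (- v) (1%:M : 'M[R]_1) =
    block_mx (1%:M + u *m v) u 0 1%:M *m block_mx 1%:M 0 (- v) 1%:M.
  rewrite mulmx_block !(mulmx1, mul1mx, mul0mx, mulmx0, addr0, add0r) mulmxN.
  by rewrite addrK.
move: E1; rewrite E2 => /(congr1 determinant).
rewrite !det_mulmx !det_ublock !det_lblock !det1 !(mul1r, mulr1) => ->.
by rewrite det_mx11 !mxE eqxx.
Qed.

(** The rank is encoded by the trace, which equals it for an idempotent: the trace is continuous, so
    the condition is closed, and it is linear, which suits rank-one exchanges. *)
Definition ortho_proj {R : realType} {n : nat} (j : nat) (P : 'M[R]_n) : Prop :=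
  [/\ P^T = P, P *m P = P & \tr P = j%:R].

Section OrthogonalProjections.
Context {R : realType} {n : nat}.
Implicit Types (P : 'M[R]_n) (x v : 'rV[R]_n).

Lemma ortho_proj_pid_mx j : (j <= n)%N -> ortho_proj j (pid_mx j : 'M[R]_n).
Proof.
move=> jn; split; [exact: tr_pid_mx|by rewrite pid_mx_id|].
rewrite /mxtrace (eq_bigr (fun i : 'I_n => (i < j)%:R)); last first.
  by move=> i _; rewrite mxE eqxx.
rewrite -natr_sum; congr _%:R.
rewrite -[RHS](card_ord j) -sum1_card (big_ord_widen n (fun=> 1%N))//.
by rewrite [RHS]big_mkcond; apply: eq_bigr => i _; case: (i < j)%N.
Qed.

Lemma mxtrace_idempotent P : P *m P = P -> \tr P = (\rank P)%:R.
Proof.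
move=> PP; have BC : row_base P *m col_base P = 1%:M.
  have /row_freeP[D BD] := row_base_free P.
  have [C CB] : exists C, C *m col_base P = 1%:M.
    by have := col_base_full P; rewrite /row_full => /row_fullP.
  have LBLB : col_base P *m row_base P *m (col_base P *m row_base P) =
         col_base P *m row_base P by rewrite !mulmx_base.
  rewrite -[LHS]mul1mx -[LHS]mulmx1 -{1}CB -{1}BD.
  have -> : C *m col_base P *m (row_base P *m col_base P) *m (row_base P *m D) =
     C *m (col_base P *m row_base P *m (col_base P *m row_base P)) *m D.
    by rewrite !mulmxA.
  by rewrite LBLB mulmxA CB mul1mx BD.
by rewrite -{1}(mulmx_base P) mxtrace_mulC BC mxtrace1.
Qed.

Lemma ortho_proj_rank j P : ortho_proj j P -> \rank P = j.
Proof.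
by case=> _ /mxtrace_idempotent -> /eqP; rewrite eqr_nat => /eqP.
Qed.

Lemma ortho_proj_reflectionK j P : ortho_proj j P ->
  (2 *: P - 1%:M) *m (2 *: P - 1%:M) = 1%:M.
Proof.
case=> _ PP _; rewrite mulmxBl !mulmxBr mulmx1 !mul1mx -scalemxAl -scalemxAr PP.
by rewrite scalerA; apply/matrixP => i k; rewrite !mxE; ring.
Qed.

Lemma ortho_proj_reflection_tr j P : ortho_proj j P ->
  (2 *: P - 1%:M)^T = 2 *: P - 1%:M.
Proof. by case=> tP _ _; rewrite linearB linearZ/= tP trmx1. Qed.

(** The Gram matrix [W W^T] is invertible, since [k W W^T = 0] forces [|k W|^2 = 0]; the projection
    is [W^T (W W^T)^-1 W]. *)
Lemma row_space_ortho_proj r (W : 'M[R]_(r, n)) : row_free W ->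
  exists2 P, ortho_proj r P &
    forall v, (exists c, v = c *m W) <-> (exists c, v = c *m P).
Proof.
move=> Wfree; have WWu : W *m W^T \in unitmx.
  rewrite -row_free_unit -kermx_eq0; apply/eqP/row_matrixP => i.
  rewrite row0; set k := row i _.
  have : k *m (W *m W^T) = 0 by rewrite -row_mul mulmx_ker row0.
  move/(congr1 (fun X => X *m k^T)); rewrite mul0mx mulmxA -mulmxA -trmx_mul.
  move/matrixP/(_ 0 0); rewrite [RHS]mxE => /eqP.
  rewrite -/(dot _ _) -/(sqn _) sqn_eq0 => /eqP/(congr1 (mulmx^~ (pinvmx W))).
  by rewrite mul0mx -mulmxA mulmxVp// mulmx1.
pose G := invmx (W *m W^T).
have GT : G^T = G by rewrite /G trmx_inv trmx_mul trmxK.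
exists (W^T *m G *m W).
  split.
  - by rewrite !trmx_mul trmxK GT mulmxA.
  - by rewrite !mulmxA -(mulmxA _ W) -(mulmxA (W^T *m G) _ G) mulmxV// mulmx1.
  - by rewrite mxtrace_mulC mulmxA mulmxV// mxtrace1.
move=> v; split=> -[c ->]; last by exists (c *m (W^T *m G)); rewrite mulmxA.
exists (c *m W); rewrite !mulmxA -(mulmxA c) -(mulmxA c) mulmxV// mulmx1//.
Qed.

Lemma mem_span_rows r (X : r.-tuple 'rV[R]_n) v :
  v \in <<X>>%VS <-> exists c, v = c *m \matrix_(i < r) X`_i.
Proof.
split=> [/coord_span ->|[c ->]].
  exists (\row_i coord X i v); rewrite mulmx_sum_row.
  by apply: eq_bigr => i _; rewrite mxE rowK.
rewrite mulmx_sum_row; apply: memv_suml => i _; rewrite rowK.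
by apply/memvZ/memv_span/mem_nth; rewrite size_tuple.
Qed.

Lemma free_rows r (X : r.-tuple 'rV[R]_n) :
  free X <-> row_free (\matrix_(i < r) X`_i).
Proof.
split=> [/freeP fX|fX].
  rewrite -kermx_eq0; apply/eqP/row_matrixP => i; rewrite row0.
  set k := row i _.
  have : k *m (\matrix_(i < r) X`_i) = 0 by rewrite -row_mul mulmx_ker row0.
  rewrite mulmx_sum_row => k0; apply/rowP => l; rewrite [RHS]mxE.
  by apply: (fX (k 0)); rewrite -[RHS]k0; apply: eq_bigr => m _; rewrite rowK.
apply/freeP => k k0 i.
have : (\row_i k i) *m (\matrix_(i < r) X`_i) = 0.
  by rewrite mulmx_sum_row -[RHS]k0; apply: eq_bigr => m _; rewrite rowK mxE.
move/(congr1 (mulmx^~ (pinvmx (\matrix_(i < r) X`_i)))).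
by rewrite mul0mx -mulmxA mulmxVp// mulmx1 => /rowP/(_ i); rewrite !mxE.
Qed.

Lemma affine_subspaceP j (U : set 'rV[R]_n) : affine_subspace j U <->
  exists p P, ortho_proj j P /\ U = [set p + v *m P | v in setT].
Proof.
split=> [[p [V [<- ->]]]|[p [P [jP ->]]]].
  have [P jP WP] := row_space_ortho_proj _ _
    ((free_rows _ (vbasis V)).1 (basis_free (vbasisP V))).
  exists p, P; split=> //; apply/seteqP; split=> _ [v vV <-].
    have /mem_span_rows/WP[c ->] : v \in <<vbasis V>>%VS.
      by rewrite (span_basis (vbasisP V)).
    by exists c.
  exists (v *m P) => //=; rewrite -(span_basis (vbasisP V)).
  by apply/mem_span_rows/WP; exists v.
pose X := [tuple row i (row_base P) | i < \rank P].
have XE : \matrix_(i < \rank P) X`_i = row_base P.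
  by apply/row_matrixP => i; rewrite rowK -tnth_nth tnth_mktuple.
exists p, <<X>>%VS; split.
  have /eqP -> : free X by apply/free_rows; rewrite XE row_base_free.
  by rewrite size_tuple (ortho_proj_rank _ _ jP).
apply/seteqP; split=> _ [v vV <-].
  exists (v *m P) => //; apply/mem_span_rows; rewrite XE.
  by exists (v *m col_base P); rewrite -mulmxA mulmx_base.
move/mem_span_rows: vV => [c ->]; rewrite XE.
have /submxP[D ->] : (row_base P <= P)%MS by rewrite eq_row_base.
by exists (c *m D) => //; rewrite mulmxA.
Qed.

(** By Pythagoras, [y0 = p + (x - p) P] is the only nearest point, so the [get] in [proj] returns
    it. *)
Lemma reflection_ortho_proj j p P x : ortho_proj j P ->
  reflection [set p + v *m P | v in setT] x =
  p + (x - p) *m (2 *: P - 1%:M).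
Proof.
case=> tP PP _; set U := [set p + v *m P | v in setT].
pose y0 := p + (x - p) *m P.
have pyth v : sqn (x - (p + v *m P)) =
    sqn (x - y0) + sqn ((x - p - v) *m P).
  have -> : x - (p + v *m P) = (x - y0) + (x - p - v) *m P.
    rewrite /y0 (mulmxBl (x - p) v P); move: ((x - p) *m P) (v *m P) => a b.
    by apply/rowP => i; rewrite !mxE; ring.
  rewrite sqnD; have -> : dot (x - y0) ((x - p - v) *m P) = 0.
    rewrite dotC dot_mulmxl tP /y0 opprD addrA mulmxBl -mulmxA PP subrr.
    by rewrite /dot trmx0 mulmx0 mxE.
  by rewrite mulr0 addr0.
have projE : Defs.proj U x = y0.
  apply: get_unique.
    split; first by exists (x - p).
    move=> _ [v _ <-]; rewrite !enormE ler_sqrt ?sqn_ge0// (pyth v).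
    by rewrite lerDl sqn_ge0.
  move=> _ [[v _ <-] /(_ y0)]; rewrite !enormE ler_sqrt ?sqn_ge0// (pyth v).
  rewrite gerDl => /(_ (ex_intro2 _ _ (x - p) I erefl)) le0.
  have : (x - p - v) *m P == 0 by rewrite -sqn_eq0 eq_le le0 sqn_ge0.
  by rewrite mulmxBl subr_eq0 => /eqP <-.
rewrite /reflection projE /y0 mulmxBr mulmx1 -scalemxAr.
by move: (_ *m P) => a; apply/rowP => i; rewrite !mxE; ring.
Qed.

End OrthogonalProjections.

(** * Continuity and compactness for matrices *)

Section MatrixTopology.
Context {R : realType}.

Lemma continuous_mx (T : topologicalType) m n (f : T -> 'M[R]_(m, n)) :
  (forall i j, continuous (fun x => f x i j)) -> continuous f.
Proof.
move=> fc x A [P xP sPA];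
  apply: (@filterS _ _ _ [set y | forall i j, P i j (f y i j)]).
  by move=> y Py; apply: sPA.
by do 2!apply: filter_forall => ?; apply: fc; exact: xP.
Qed.

Lemma continuous_sumR (T : topologicalType) (I : Type) (r : seq I) (P : pred I)
    (f : I -> T -> R) :
  (forall i, continuous (f i)) -> continuous (fun x => \sum_(i <- r | P i) f i
    x).
Proof.
move=> fc; elim: r => [|i r IH]; first by under eq_fun do rewrite big_nil;
  exact: cst_continuous.
under eq_fun do rewrite big_cons.
by case: (P i) => // x; apply: continuousD; [exact: fc|exact: IH].
Qed.

Lemma continuous_prodR (T : topologicalType) (I : Type) (r : seq I) (P : pred I)
    (f : I -> T -> R) :
  (forall i, continuous (f i)) -> continuous (fun x => \prod_(i <- r | P i) f i
    x).
Proof.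
move=> fc; elim: r => [|i r IH]; first by under eq_fun do rewrite big_nil;
  exact: cst_continuous.
under eq_fun do rewrite big_cons.
by case: (P i) => // x; apply: continuousM; [exact: fc|exact: IH].
Qed.

Lemma continuous_entry (T : topologicalType) m n (f : T -> 'M[R]_(m, n)) i j :
  continuous f -> continuous (fun x => f x i j).
Proof.
by move=> fc x; apply: (@continuous_comp _ _ _ f (fun M => M i j));
  [exact: fc|exact: coord_continuous].
Qed.

Lemma continuous_mulmx (T : topologicalType) m n p (f : T -> 'M[R]_(m, n))
    (g : T -> 'M[R]_(n, p)) :
  continuous f -> continuous g -> continuous (fun x => f x *m g x).
Proof.
move=> fc gc; apply: continuous_mx => i j; under eq_fun do rewrite mxE.
by apply: continuous_sumR => k x; apply: continuousM; apply: continuous_entry.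
Qed.

Lemma continuous_trmx (T : topologicalType) m n (f : T -> 'M[R]_(m, n)) :
  continuous f -> continuous (fun x => (f x)^T).
Proof.
move=> fc; apply: continuous_mx => i j; under eq_fun do rewrite mxE.
exact: continuous_entry.
Qed.

Lemma continuous_mxtrace (T : topologicalType) n (f : T -> 'M[R]_n) :
  continuous f -> continuous (fun x => \tr (f x)).
Proof. by move=> fc; apply: continuous_sumR => i; apply: continuous_entry. Qed.

Lemma continuous_det (T : topologicalType) n (f : T -> 'M[R]_n) :
  continuous f -> continuous (fun x => \det (f x)).
Proof.
move=> fc; apply: (@continuous_sumR _ _ _ _
  (fun (s : 'S_n) x => (-1) ^+ s * \prod_(i < n) f x i (s i))) => s x.
apply: (@continuousM _ _ (fun=> (-1) ^+ s) (fun x => \prod_(i < n) f x i (s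
  i))).
  exact: cst_continuous.
by apply: continuous_prodR => i; apply: continuous_entry.
Qed.

Lemma continuous_dot (T : topologicalType) n (f g : T -> 'rV[R]_n) :
  continuous f -> continuous g -> continuous (fun x => dot (f x) (g x)).
Proof.
move=> fc gc; apply: continuous_entry; apply: continuous_mulmx => //.
exact: continuous_trmx.
Qed.

Lemma continuous_addmx (T : topologicalType) m n (f g : T -> 'M[R]_(m, n)) :
  continuous f -> continuous g -> continuous (fun x => f x + g x).
Proof. by move=> fc gc x; apply: continuousD; [exact: fc|exact: gc]. Qed.

Lemma continuous_submx (T : topologicalType) m n (f g : T -> 'M[R]_(m, n)) :
  continuous f -> continuous g -> continuous (fun x => f x - g x).
Proof. by move=> fc gc x; apply: continuousB; [exact: fc|exact: gc]. Qed.

Lemma continuous_scalemx (T : topologicalType) m n (s : T -> R)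
    (f : T -> 'M[R]_(m, n)) :
  continuous s -> continuous f -> continuous (fun x => s x *: f x).
Proof. by move=> sc fc x; apply: continuousZ; [exact: sc|exact: fc]. Qed.

Lemma closed_eq_set (T : topologicalType) m n (f g : T -> 'M[R]_(m, n)) :
  continuous f -> continuous g -> closed [set x | f x = g x].
Proof.
move=> fc gc.
rewrite (_ : mkset _ = (fun x => f x - g x) @^-1` [set 0]).
  apply: preimage_closed => [x _|]; last first.
    by apply: accessible_closed_set1; apply: hausdorff_accessible;
      exact: norm_hausdorff.
  by apply: continuousB; [exact: fc|exact: gc].
by apply/seteqP; split=> x /= => [->|/eqP]; rewrite ?subrr// subr_eq0 => /eqP.
Qed.

Lemma closed_forall (T : topologicalType) (I : Type) (D : set I)
    (A : I -> set T) :
  (forall i, D i -> closed (A i)) -> closed [set x | forall i, D i -> A i x].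
Proof. by move=> cA; rewrite [mkset _](_ : _ = \bigcap_(i in D) A i)//;
  apply: closed_bigI. Qed.

Lemma closed_entries_le m n (B : R) :
  closed [set M : 'M[R]_(m, n) | forall i j, `|M i j| <= B].
Proof.
rewrite (_ : mkset _ = \bigcap_i \bigcap_j [set M : 'M[R]_(m, n) | `|M i j| <=
  B]).
  apply: closed_bigI => i _; apply: closed_bigI => j _.
  rewrite (_ : mkset _ = (fun M : 'M[R]_(m, n) => `|M i j|) @^-1` [set x | x <=
    B])//.
  apply: preimage_closed => [M _|]; last exact: closed_le.
  by apply: continuous_comp; [exact: coord_continuous|exact: norm_continuous].
by apply/seteqP; split=> M MB => [i _ j _|i j]; [exact: MB|exact: (MB i I j I)].
Qed.

(** [vec_mx] carries a cube of row vectors, compact as a product of segments, onto a set containing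
    [A]. *)
Lemma mx_bounded_closed_compact m n (A : set 'M[R]_(m, n)) (B : R) :
  (forall M, A M -> forall i j, `|M i j| <= B) -> closed A -> compact A.
Proof.
move=> AB cA.
have := @rV_compact R (m * n) (fun=> `[- B, B]%classic) (fun=> @segment_compact
  _ _ _).
set C := [set v | _] => Cc.
apply: (subclosed_compact cA (B := vec_mx @` C)).
  apply: continuous_compact Cc; apply: continuous_subspaceT.
  apply: continuous_mx => i j; under eq_fun do rewrite mxE.
  exact: coord_continuous.
move=> M AM; exists (mxvec M); last by rewrite mxvecK.
move=> k; case/mxvec_indexP: k => i j; rewrite mxvecE /= in_itv/= -ler_norml.
exact: AB.
Qed.

Lemma compact_sqn_le n (K : set 'rV[R]_n) :
  compact K -> exists2 r, 0 < r & forall x, K x -> sqn x <= r ^+ 2.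
Proof.
move=> cK; have [->|K0] := eqVneq K set0; first by exists 1.
have /set0P K1 := K0.
have [c _ cmax] := @compact_EVT_max _ _ (@sqn R n) K K1 cK (continuous_subspaceT
  (continuous_dot _ _ _ _ (fun=> cvg_id) (fun=> cvg_id))).
exists (1 + sqn c); first by have := sqn_ge0 c; lra.
by move=> x Kx; have := cmax x (mem_set Kx); have := sqn_ge0 c; nra.
Qed.

(** The library ball is a sup-norm ball. Entries are at most the Euclidean norm, and halving the
    radius restores strictness. *)
Lemma interior_sqn_ball n (K : set 'rV[R]_n) : interior K !=set0 ->
  exists c r, 0 < r /\ forall x, sqn (x - c) <= r ^+ 2 -> K x.
Proof.
case=> c /nbhs_ballP[e /= e0 eK]; exists c, (e / 2); split;
  first by rewrite divr_gt0.
move=> x xc; apply: eK; split=> // i j; rewrite (ord1 i).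
rewrite /ball/= -normrN opprB; apply: (@le_lt_trans _ _ (e / 2)); last by lra.
by have := entry_le_sqn (x - c) j (e / 2) _ xc; rewrite !mxE; apply; lra.
Qed.

End MatrixTopology.

(** * Chirality in terms of orthogonal projections *)

(* Since [F] is an isometric involution in all uses, this says that a translate
   of [l] times the image of [K] under [F] contains [K]. *)
Definition fits {R : realType} {n : nat} (K : set 'rV[R]_n) (F : 'M[R]_n)
    (l : R) : Prop :=
  exists w, forall x, K x -> K (l^-1 *: (x *m F) + w).

Section Chirality.
Context {R : realType} {n : nat} (K : set 'rV[R]_n).
Context (hK : convex_body K).
Implicit Types (A F P : 'M[R]_n) (U : set 'rV[R]_n) (l : R).

Lemma convex_body_mix x y t : K x -> K y -> 0 <= t -> t <= 1 ->
  K (t *: x + (1 - t) *: y).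
Proof.
case: hK => _ cK _ Kx Ky t0 t1.
have tP : Itv.spec (@Itv.num_sem R) (Itv.Real `[0%Z, 1%Z]) t.
  by rewrite /= /Itv.num_sem/= num_real/= in_itv/= t0 t1.
by have /set_mem := cK x y (Itv.mk tP) (mem_set Kx) (mem_set Ky).
Qed.

Lemma fits_of_ellipsoid A F c d l : 0 < l ->
  (forall x, K x -> sqn ((x - d) *m A) <= 1) ->
  (forall x, sqn ((x - c) *m A) <= l^-1 ^+ 2 -> K x) ->
  (forall u, sqn (u *m F *m A) = sqn (u *m A)) -> fits K F l.
Proof.
move=> l0 KA AK FA; exists (c - l^-1 *: (d *m F)) => x Kx; apply: AK.
have -> : l^-1 *: (x *m F) + (c - l^-1 *: (d *m F)) - c =
    l^-1 *: ((x - d) *m F).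
  rewrite mulmxBl; move: (x *m F) (d *m F) => a b.
  by apply/rowP => i; rewrite !mxE; ring.
rewrite -scalemxAl sqnZ FA; have := KA _ Kx; have := sqr_ge0 l^-1; nra.
Qed.

Lemma ortho_proj_isometry j P : ortho_proj j P ->
  forall u, sqn (u *m (2 *: P - 1%:M)) = sqn u.
Proof.
move=> jP; apply: sqn_isometry.
by rewrite (ortho_proj_reflection_tr j)// (ortho_proj_reflectionK j).
Qed.

(** A ball inside [K] and a ball around it serve as the two ellipsoids. Hence the infima below are
    over nonempty sets and are not default values. *)
Lemma fits_exists j P : ortho_proj j P ->
  exists2 l, 0 < l & fits K (2 *: P - 1%:M) l.
Proof.
move=> jP; case: hK => cK _ /interior_sqn_ball[c [r [r0 rK]]].
have [m m0 mK] := compact_sqn_le _ K cK.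
exists (m / r); first by rewrite divr_gt0.
apply: (fits_of_ellipsoid (m^-1)%:M _ c 0) => [|x /mK xm|x|u].
- by rewrite divr_gt0.
- rewrite subr0 mul_mx_scalar sqnZ exprVn mulrC ler_pdivrMr ?exprn_gt0//.
  by rewrite mul1r.
- rewrite mul_mx_scalar sqnZ invf_div exprMn [leRHS]mulrC => H.
  by apply: rK; move: H; rewrite ler_pM2l// exprn_gt0// invr_gt0.
- by rewrite !mul_mx_scalar !sqnZ (ortho_proj_isometry j).
Qed.

Context (hn : (0 < n)%N).

(** The map scales distances by [l^-1]. A pair of points of [K] at maximal distance, positive
    because [K] contains a ball, thus forces [l^-1 <= 1]. *)
Lemma fits_ge1 F l : 0 < l -> (forall u, sqn (u *m F) = sqn u) ->
  fits K F l -> 1 <= l.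
Proof.
move=> l0 isoF [w wK]; case: hK => cK _ /interior_sqn_ball[c [r [r0 rK]]].
have Kc : K c by apply: rK; rewrite subrr -(scale0r 0) sqnZ; nra.
have [e e1] := exists_unit_vector (R := R) hn.
have Kce : K (c + r *: e) by apply: rK;
  rewrite addrAC subrr add0r sqnZ e1 mulr1.
have cf : continuous (fun z : 'rV[R]_n * 'rV[R]_n => sqn (z.1 - z.2)).
  have cD : continuous (fun z : 'rV[R]_n * 'rV[R]_n => z.1 - z.2).
    by move=> z; apply: continuousB; [exact: cvg_fst|exact: cvg_snd].
  exact: continuous_dot.
have [|[x y] /set_mem[/= Kx Ky] xymax] := @compact_EVT_max _ _ _ (K `*` K) _
  (compact_setX cK cK) (continuous_subspaceT cf).
  by exists (c, c).
have M0 : 0 < sqn (x - y).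
  apply: lt_le_trans (xymax (c + r *: e, c) _); last exact/mem_set.
  by rewrite /= addrAC subrr add0r sqnZ e1 mulr1 exprn_gt0.
have := xymax (_, _) (mem_set (conj (wK _ Kx) (wK _ Ky))).
rewrite /= opprD addrACA subrr addr0 -scalerBr -mulmxBl sqnZ isoF.
rewrite ger_pMl// expr_le1// ?invr_ge0 ?(ltW l0)//.
by rewrite invf_le1.
Qed.

(** Applying the involutive reflection to the inclusion turns it into [fits]. The base point [p]
    only alters the translation, so the linear part alone matters. *)
Lemma circumradius_reflection j p P : ortho_proj j P ->
  circumradius K (reflection [set p + v *m P | v in setT] @` K) =
  inf [set l | 0 < l /\ fits K (2 *: P - 1%:M) l].
Proof.
move=> jP; congr inf; apply/seteqP.
have FF := ortho_proj_reflectionK _ _ jP.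
have refl x := reflection_ortho_proj j p P x jP.
set F := 2 *: P - 1%:M in FF refl *.
split=> l [l0 [z zK]]; split=> //.
  exists (p - p *m F - l^-1 *: (z *m F)) => x /zK[_ [y Ky <-]].
  rewrite refl => <-.
  rewrite mulmxDl -scalemxAl mulmxDl -mulmxA FF mulmx1 scalerDr scalerA.
  rewrite mulVf ?gt_eqF// scale1r.
  have <- : y = l^-1 *: (z *m F) + (p *m F + (y - p)) +
            (p - p *m F - l^-1 *: (z *m F)).
    move: (p *m F) (z *m F) => a b.
    by apply/rowP => i; rewrite !mxE; ring.
  by [].
exists (- l *: (p + (z - p) *m F)) => x Kx.
exists (p + ((l^-1 *: (x *m F) + z) - p) *m F).
  by rewrite -refl; exists (l^-1 *: (x *m F) + z) => //; apply: zK.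
rewrite -(addrA (l^-1 *: _)) (mulmxDl (l^-1 *: _)) -scalemxAl -mulmxA FF mulmx1.
move: ((z - p) *m F) => a.
by apply/rowP => i; rewrite !mxE; field; rewrite gt_eqF.
Qed.

Lemma fits_inf_le j P l : ortho_proj j P -> 0 < l ->
  fits K (2 *: P - 1%:M) l ->
  inf [set l | 0 < l /\ fits K (2 *: P - 1%:M) l] <= l.
Proof.
move=> jP l0 Fl; apply: ge_inf; last by split.
by exists 0 => y [/ltW].
Qed.

Lemma fits_inf_ge1 j P : ortho_proj j P ->
  1 <= inf [set l | 0 < l /\ fits K (2 *: P - 1%:M) l].
Proof.
move=> jP; apply: lb_le_inf.
  by have [l l0 Fl] := fits_exists j P jP; exists l.
by move=> l [l0]; apply: fits_ge1 => //; exact: ortho_proj_isometry jP.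
Qed.

Lemma chirality_has_lbound j :
  has_lbound [set circumradius K (reflection U @` K) |
              U in [set U | affine_subspace j U]].
Proof.
exists 1 => _ [U /affine_subspaceP[p [P [jP ->]]] <-].
by rewrite (circumradius_reflection j)// (fits_inf_ge1 j).
Qed.

Lemma chirality_le_fits j P l : ortho_proj j P -> 0 < l ->
  fits K (2 *: P - 1%:M) l -> chirality j K <= l.
Proof.
move=> jP l0 Fl; apply: le_trans (fits_inf_le _ _ _ jP l0 Fl).
rewrite -(circumradius_reflection _ 0 _ jP).
apply: ge_inf; first exact: chirality_has_lbound.
by exists [set 0 + v *m P | v in setT] => //; apply/affine_subspaceP;
  exists 0, P.
Qed.

Lemma chirality_nonempty j : (j <= n)%N ->
  [set circumradius K (reflection U @` K) |
              U in [set U | affine_subspace j U]] !=set0.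
Proof.
move=> jn; eexists;
  exists [set 0 + v *m (pid_mx j : 'M[R]_n) | v in setT] => //.
by apply/affine_subspaceP; exists 0, (pid_mx j); split=> //;
  apply: ortho_proj_pid_mx.
Qed.

Lemma chirality_ge1 j : (j <= n)%N -> 1 <= chirality j K.
Proof.
move=> jn; apply: lb_le_inf; first exact: chirality_nonempty.
move=> _ [U /affine_subspaceP[p [P [jP ->]]] <-].
by rewrite (circumradius_reflection j)// (fits_inf_ge1 j).
Qed.

Lemma chirality_lt_fits j c : (j <= n)%N -> chirality j K < c ->
  exists P l, [/\ ortho_proj j P, 0 < l < c & fits K (2 *: P - 1%:M) l].
Proof.
move=> jn /(inf_lt (chirality_nonempty j jn))[].
move=> _ [U /affine_subspaceP[p [P [jP ->]]] <-].
rewrite (circumradius_reflection j)// => /inf_lt[].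
  by have [l l0 Fl] := fits_exists j P jP; exists l.
by move=> l [l0 Fl] lc; exists P, l; rewrite l0.
Qed.

End Chirality.

(** * Invariant subspaces of symmetric matrices *)

Lemma sqn_normalize {R : realType} n (u : 'rV[R]_n) : u != 0 ->
  exists2 k, 0 < k & sqn (k *: u) = 1.
Proof.
rewrite -sqn_gt0 => u0; exists (Num.sqrt (sqn u))^-1.
  by rewrite invr_gt0 sqrtr_gt0.
by rewrite sqnZ exprVn sqr_sqrtr ?(ltW u0)// mulVf ?gt_eqF.
Qed.

Lemma mxtrace_outer {R : realType} n (u v : 'rV[R]_n) : \tr (u^T *m v) = dot u
  v.
Proof. by rewrite mxtrace_mulC /mxtrace big_ord1 -[LHS]/(dot v u) dotC. Qed.

(* The projection is a maximizer of [tr (P S)]: rotating a unit vector of its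
   range towards a unit vector of its kernel cannot increase the trace, so the
   two are [S]-orthogonal. *)
Section InvariantSubspace.
Context {R : realType} {n : nat}.
Implicit Types (P S : 'M[R]_n) (a b : 'rV[R]_n).

Lemma compact_ortho_proj j : compact [set P : 'M[R]_n | ortho_proj j P].
Proof.
apply: (@mx_bounded_closed_compact _ _ _ _ 1) => [P [tP PP _] i k|].
  (* For a symmetric idempotent, row [i] has squared norm [P i i]; hence [(P i i)^2 <= P i i], and
     all entries are at most 1 in absolute value. *)
  have rowP l : P i l ^+ 2 <= P i i.
    have <- : sqn (row i P) = P i i.
      rewrite /sqn /dot tr_row tP -[in RHS]PP -row_mul !mxE.
      by apply: eq_bigr => m _; rewrite !mxE.
    by have := sqr_entry_le (row i P) l; rewrite mxE.
  have Pii : P i i <= 1 by have := rowP i; nra.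
  rewrite -(ler_pXn2r (n := 2)) ?nnegrE// real_normK ?num_real// expr1n.
  exact: le_trans (rowP k) Pii.
rewrite (_ : mkset _ = [set P : 'M[R]_n | P^T = P] `&`
   ([set P : 'M[R]_n | P *m P = P] `&` [set P : 'M[R]_n | \tr P = j%:R])).
  have idc : continuous (@id 'M[R]_n) by move=> ?; exact: cvg_id.
  apply: closedI; last apply: closedI.
  - by apply: closed_eq_set => //; exact: continuous_trmx.
  - by apply: closed_eq_set => //; exact: continuous_mulmx.
  - rewrite (_ : mkset _ = (fun P : 'M[R]_n => \tr P) @^-1` [set j%:R])//.
    apply: preimage_closed => [P _|];
      first exact: (continuous_mxtrace _ _ _ idc).
    exact: closed_eq.
by apply/seteqP; split=> P [? []].
Qed.

(** [P - a^T a] projects onto the part of the range of [P] orthogonal to [a]. Since [a'] is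
    orthogonal to that part, adding its line restores the rank. *)
Lemma ortho_proj_swap j P a a' : ortho_proj j P -> a *m P = a ->
  sqn a = 1 -> sqn a' = 1 -> a' *m (P - a^T *m a) = 0 ->
  ortho_proj j (P - a^T *m a + a'^T *m a').
Proof.
move=> [tP PP trP] aP a1 a'1 a'0; set E := P - a^T *m a in a'0 *.
have sq1 (u : 'rV[R]_n) : sqn u = 1 -> u *m u^T = 1%:M.
  by move=> u1; rewrite [LHS]mx11_scalar -/(dot u u) -/(sqn u) u1.
have tE : E^T = E by rewrite /E linearB/= trmx_mul trmxK tP.
have a0 : E *m a'^T = 0 by rewrite -[LHS]trmxK trmx_mul trmxK tE a'0 trmx0.
have Pa : P *m a^T = a^T by rewrite -[LHS]trmxK trmx_mul trmxK tP aP.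
have EE : E *m E = E.
  rewrite /E mulmxBl !mulmxBr PP -!mulmxA aP !mulmxA Pa -(mulmxA a^T) sq1//.
  by rewrite mulmx1 subrr subr0.
split.
- by rewrite linearD/= tE trmx_mul trmxK.
- clearbody E;
  rewrite mulmxDl !mulmxDr EE mulmxA a0 mul0mx -!mulmxA a'0 mulmx0 addr0 add0r.
  by rewrite (mulmxA a') sq1// mul1mx.
- by rewrite /E !linearD linearN/= trP !mxtrace_outer -/(sqn a) -/(sqn a') a1
  a'1 subrK.
Qed.

(** Near [(c, s) = (1, 0)] the left side is [al + 2 s be] to first order, so a nonzero [be] would
    let it exceed [al]. *)
Lemma rotation_stationary (al be ga : R) :
  (forall c s, c ^+ 2 + s ^+ 2 = 1 ->
    c ^+ 2 * al + 2 * (c * s) * be + s ^+ 2 * ga <= al) -> be = 0.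
Proof.
move=> H; apply/eqP; rewrite -sqrf_eq0; apply/contraT => be0.
have be2 : 0 < be ^+ 2 by rewrite lt_neqAle eq_sym be0 sqr_ge0.
pose D := al - ga; pose N := `|be| + `|D| + 1.
have N1 : 1 <= N by rewrite lerDr addr_ge0.
(* With [t = be * k], this choice gives [t^2 <= 1/4] and [k D <= 1/2], so the final factor
   [1 - t^2 - k D] is positive. *)
pose k := (2 * N)^-1.
have k0 : 0 < k by rewrite invr_gt0; lra.
have kN : k * N = 1 / 2 by rewrite /k; field; lra.
have kD : k * D <= 1 / 2.
  rewrite -kN ler_pM2l// /N; have := ler_norm D; have := normr_ge0 be; lra.
pose t := be * k.
have t2 : t ^+ 2 <= 1 / 4.
  have t1 : `|t| <= 1 / 2.
    rewrite /t normrM (gtr0_norm k0) mulrC -kN ler_pM2l// /N.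
    by have := normr_ge0 D; lra.
  by rewrite -(real_normK (num_real t)); have := normr_ge0 t; nra.
have p0 : 0 < 1 + t ^+ 2 by have := sqr_ge0 t; lra.
(* Rational parametrization of the unit circle. *)
have := H ((1 - t ^+ 2) / (1 + t ^+ 2)) (2 * t / (1 + t ^+ 2)).
have -> : ((1 - t ^+ 2) / (1 + t ^+ 2)) ^+ 2 + (2 * t / (1 + t ^+ 2)) ^+ 2 = 1.
  by field; rewrite gt_eqF.
move=> /(_ erefl); rewrite -(ler_pM2r (exprn_gt0 2 p0)).
rewrite [X in X <= _](_ : _ = (1 - t ^+ 2) ^+ 2 * al +
   4 * (t * (1 - t ^+ 2)) * be + 4 * t ^+ 2 * ga); last first.
  by field; rewrite gt_eqF.
rewrite -subr_le0 (_ : _ - _ = 4 * (be ^+ 2 * k) * ((1 - t ^+ 2) - k * D)).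
  have pk : 0 < be ^+ 2 * k by exact: mulr_gt0.
  by rewrite -mulrA !pmulr_rle0//; move: (t ^+ 2) (k * D) t2 kD => x y; lra.
by rewrite /t /D; ring.
Qed.

Lemma exists_ortho_proj_commute j S : (j <= n)%N -> S^T = S ->
  exists2 P, ortho_proj j P & P *m S = S *m P.
Proof.
move=> jn tS.
have idc : continuous (@id 'M[R]_n) by move=> ?; exact: cvg_id.
have fc : continuous (fun P : 'M[R]_n => \tr (P *m S)).
  apply: continuous_mxtrace; apply: continuous_mulmx => //;
    exact: cst_continuous.
have [|P /set_mem/= jP Pmax] := compact_EVT_max _ (compact_ortho_proj j)
  (continuous_subspaceT fc).
  by exists (pid_mx j); exact: ortho_proj_pid_mx.
exists P => //; have [tP PP _] := jP.
have unit_orth a b : a *m P = a -> b *m P = 0 -> sqn a = 1 -> sqn b = 1 ->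
    dot (a *m S) b = 0.
  move=> aP bP a1 b1.
  have ab0 : dot a b = 0.
    by rewrite -aP dot_mulmxl tP bP /dot trmx0 mulmx0 mxE.
  have ba0 : b *m a^T = 0.
    by rewrite [LHS]mx11_scalar -/(dot b a) dotC ab0 raddf0.
  have aa1 : a *m a^T = 1%:M by rewrite [LHS]mx11_scalar -/(dot a a) -/(sqn a)
    a1.
  apply: (rotation_stationary (dot (a *m S) a) _ (dot (b *m S) b)) => c s cs1.
  pose a' := c *: a + s *: b.
  have a'1 : sqn a' = 1 by rewrite sqnD !dot_lin !sqnZ a1 b1 ab0; lra.
  have a'0 : a' *m (P - a^T *m a) = 0.
    rewrite mulmxBr mulmxA !mulmxDl -!scalemxAl aP bP aa1 ba0.
    by rewrite mul0mx mul1mx scaler0 addr0 subrr.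
  have := Pmax _ (mem_set (ortho_proj_swap _ _ _ _ jP aP a1 a'1 a'0)).
  have -> (x : 'rV[R]_n) : \tr ((P - a^T *m a + x^T *m x) *m S) =
      \tr (P *m S) - dot a (a *m S) + dot x (x *m S).
    by rewrite !mulmxDl mulNmx !linearD linearN/= -!mulmxA !mxtrace_outer.
  rewrite -addrA gerDl addrC subr_le0 /a'.
  have -> : dot (c *: a + s *: b) ((c *: a + s *: b) *m S) =
      c ^+ 2 * dot (a *m S) a + 2 * (c * s) * dot (a *m S) b +
      s ^+ 2 * dot (b *m S) b.
    rewrite mulmxDl -!scalemxAl !dot_lin (dotC a (a *m S)) (dotC b (b *m S)).
    rewrite (dotC a (b *m S)) (dot_mulmxl b a) tS (dotC b (a *m S)); ring.
  by rewrite (dotC a).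
have range_ker u v : dot (u *m P *m S) (v *m (1%:M - P)) = 0.
  have [->|/sqn_normalize[k k0 k1]] := eqVneq (u *m P) 0.
    by rewrite mul0mx /dot mul0mx mxE.
  have [->|/sqn_normalize[l l0 l1]] := eqVneq (v *m (1%:M - P)) 0.
    by rewrite /dot trmx0 mulmx0 mxE.
  have := unit_orth _ _ _ _ k1 l1.
  rewrite -!scalemxAl -!mulmxA PP mulmxBl mul1mx PP subrr mulmx0 scaler0.
  move=> /(_ erefl erefl); rewrite !dot_lin => /eqP.
  by rewrite !mulf_eq0 (gt_eqF k0) (gt_eqF l0) /= => /eqP.
have PSQ : P *m S *m (1%:M - P) = 0.
  apply/matrixP => i k;
    rewrite [RHS]mxE -[RHS](range_ker (delta_mx 0 i) (delta_mx 0 k)).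
  have tQ : (1%:M - P)^T = 1%:M - P by rewrite linearB/= trmx1 tP.
  rewrite -{2}tQ -dot_mulmxl dot_delta_row -!mulmxA -rowE.
  by rewrite [RHS]mxE.
(* The right side is symmetric, so transposition yields [S P = P S P] as well. *)
have PSP : P *m S = P *m S *m P.
  by apply/eqP; rewrite -subr_eq0 -{1}(mulmx1 (P *m S)) -mulmxBr PSQ.
have SPS := congr1 trmx PSP; rewrite !trmx_mul tP tS mulmxA in SPS.
by rewrite PSP SPS.
Qed.

(** [|u A|^2] is the quadratic form of [A A^T]. It is preserved by a symmetric involution commuting
    with that matrix. *)
Lemma exists_ortho_proj_preserves j (A : 'M[R]_n) : (j <= n)%N ->
  exists2 P, ortho_proj j P &
    forall u, sqn (u *m (2 *: P - 1%:M) *m A) = sqn (u *m A).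
Proof.
move=> jn; have tS : (A *m A^T)^T = A *m A^T by rewrite trmx_mul trmxK.
have [P jP PS] := exists_ortho_proj_commute j _ jn tS; exists P => // u.
have FF := ortho_proj_reflectionK _ _ jP.
have tF := ortho_proj_reflection_tr _ _ jP.
have FS : (2 *: P - 1%:M) *m (A *m A^T) = A *m A^T *m (2 *: P - 1%:M).
  by rewrite mulmxBl mulmxBr -scalemxAl -scalemxAr PS mul1mx mulmx1.
set F := 2 *: P - 1%:M in FF tF FS *.
rewrite /sqn !(dot_mulmxl _ _ A) -!(mulmxA _ A) -(mulmxA u F) FS dot_mulmxl tF.
by rewrite -!mulmxA FF mulmx1.
Qed.

End InvariantSubspace.

(** * The minimal enclosing ellipsoid *)

Section Loewner.
Context {R : realType} {n : nat} (K : set 'rV[R]_n).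
Context (hK : convex_body K).
Implicit Types (A : 'M[R]_n) (z e : 'rV[R]_n).

Definition encloses (A : 'M[R]_n) (z : 'rV[R]_n) : Prop :=
  forall x, K x -> sqn (x *m A - z) <= 1.

(** If [K] contains the ball of radius [r] about [c], then [c] and [c + r e_i] both go into one unit
    ball, so row [i] of [r A] has entries at most 2. Then [z] stays near the bounded point [c A]. *)
Lemma encloses_bounded : exists B, forall A z, encloses A z ->
  (forall i k, `|A i k| <= B) /\ (forall k, `|z 0 k| <= B).
Proof.
have [_ _ /interior_sqn_ball[c [r [r0 rK]]]] := hK.
have Kc : K c by apply: rK; rewrite subrr -(scale0r 0) sqnZ; nra.
pose C := \sum_i `|c 0 i|.
have C0 : 0 <= C by exact: sumr_ge0.
exists (2 / r * (1 + C) + 1) => A z KA.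
have B0 : 0 <= 2 / r by rewrite divr_ge0 ?ltW.
have Aik i k : `|A i k| <= 2 / r.
  have Kci : K (c + r *: delta_mx 0 i).
    by apply: rK;
      rewrite addrAC subrr add0r sqnZ /sqn dot_delta_row mxE !eqxx mulr1.
  have le1 x : K x -> `|(x *m A - z) 0 k| <= 1.
    by move=> /KA xA; apply: entry_le_sqn; rewrite ?expr1n.
  have := le1 _ Kc; have := le1 _ Kci; rewrite mulmxDl -scalemxAl -rowE !mxE.
  move: (\sum_j _) (z 0 k) => p q H1 H2; rewrite ler_pdivlMr// mulrC.
  rewrite -{1}(gtr0_norm r0) -normrM.
  have -> : r * A i k = (p + r * A i k - q) - (p - q) by ring.
  apply: le_trans (ler_normB _ _) _; lra.
split=> [i k|k]; first by apply: le_trans (Aik i k) _; nra.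
have -> : z 0 k = (c *m A) 0 k - (c *m A - z) 0 k by rewrite !mxE; ring.
apply: le_trans (ler_normB _ _) _; apply: lerD; last first.
  by apply: entry_le_sqn; rewrite ?expr1n//; exact: KA.
apply: (@le_trans _ _ (2 / r * C)); last by nra.
rewrite mxE mulr_sumr; apply: le_trans (ler_norm_sum _ _ _) _.
by apply: ler_sum => i _; rewrite normrM mulrC ler_wpM2r.
Qed.

Lemma compact_encloses : compact [set Az : 'M[R]_n * 'rV[R]_n | encloses Az.1
  Az.2].
Proof.
have [B BP] := encloses_bounded.
pose CA := [set A : 'M[R]_n | forall i k, `|A i k| <= B].
pose Cz := [set z : 'rV[R]_n | forall i k, `|z i k| <= B].
have cCA : compact CA by apply: (mx_bounded_closed_compact _ _ _ B) => //;
  exact: closed_entries_le.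
have cCz : compact Cz by apply: (mx_bounded_closed_compact _ _ _ B) => //;
  exact: closed_entries_le.
apply: (subclosed_compact _ (compact_setX cCA cCz)) => [|[A z] /BP[/= HA Hz]];
  last first.
  by split=> // i k; rewrite (ord1 i).
apply: closed_forall => x _.
pose f (Az : 'M[R]_n * 'rV[R]_n) := sqn (x *m Az.1 - Az.2).
change (closed (f @^-1` [set y | y <= 1])).
apply: preimage_closed => [Az _|]; last exact: closed_le.
have c1 : continuous (fun Az : 'M[R]_n * 'rV[R]_n => x *m Az.1 - Az.2).
  apply: continuous_submx => [|?]; last exact: cvg_snd.
  by apply: continuous_mulmx => ?; [exact: cst_continuous|exact: cvg_fst].
exact: (continuous_dot _ _ _ _ c1 c1).
Qed.

(** Minimal volume means maximal [det^2]. Comparison with the scalar matrix of an enclosing ball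
    shows that the maximizer is invertible. *)
Lemma exists_loewner : exists A z, [/\ A \in unitmx, encloses A z &
  forall A' z', encloses A' z' -> \det A' ^+ 2 <= \det A ^+ 2].
Proof.
have [m m0 mK] : exists2 r, 0 < r & forall x, K x -> sqn x <= r ^+ 2.
  by apply: compact_sqn_le; case: hK.
have E0 : encloses (m^-1)%:M 0.
  move=> x /mK xm; rewrite subr0 mul_mx_scalar sqnZ exprVn mulrC.
  by rewrite ler_pdivrMr ?exprn_gt0// mul1r.
have dc : continuous (fun Az : 'M[R]_n * 'rV[R]_n => \det Az.1 ^+ 2).
  have dc : continuous (fun Az : 'M[R]_n * 'rV[R]_n => \det Az.1).
    by apply: continuous_det => ?; exact: cvg_fst.
  pose f (Az : 'M[R]_n * 'rV[R]_n) : R := \det Az.1.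
  change (continuous (f \* f)) => Az.
  by apply: continuousM; exact: dc.
have [|[A z] /set_mem/= KA Amax] := compact_EVT_max _ compact_encloses
  (continuous_subspaceT dc).
  by exists ((m^-1)%:M, 0).
exists A, z; split=> // [|A' z' KA'].
  rewrite unitmxE unitfE -sqrf_eq0 gt_eqF//.
  apply: lt_le_trans (Amax (_, _) (mem_set E0)).
  by rewrite /= det_scalar exprn_gt0// exprn_gt0// invr_gt0.
exact: (Amax (A', z') (mem_set KA')).
Qed.

(* If [n a b < 1], the ellipsoid [|y|^2 + mu (<y,e> - a) (<y,e> + b) <= 1],
   which contains the slab of the unit ball, has smaller volume than the ball
   for small [mu > 0]. *)
Lemma slab_improvement (a b : R) : (0 < n)%N -> n%:R * (a * b) < 1 ->
  exists mu k, [/\ 0 < mu, 1 + mu * (a * b) + mu ^+ 2 * (b - a) ^+ 2 / 4 <= k,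
    1 <= k & k ^+ n < 1 + mu].
Proof.
move=> n0 nab; have N0 : 0 < n%:R :> R by rewrite ltr0n.
(* [a * b] may be negative, so its positive part is used; [th] then lies strictly between it and
   [1/n]. *)
pose eta := Num.max 0 (a * b).
have ab_eta : a * b <= eta by rewrite le_max lexx orbT.
have eta0 : 0 <= eta by rewrite le_max lexx.
have neta : n%:R * eta < 1.
  by rewrite /eta; case: (leP 0 (a * b)) => _; rewrite ?mulr0.
pose th := (eta + n%:R^-1) / 2.
have nV : n%:R * n%:R^-1 = 1 :> R by rewrite mulfV ?gt_eqF.
have eta_lt : eta < n%:R^-1 by rewrite -(ltr_pM2l N0) nV.
have eta_th : eta < th by rewrite /th; lra.
have nth : n%:R * th < 1 by rewrite /th mulrA mulrDr nV; lra.
pose C := (b - a) ^+ 2 / 4.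
have C0 : 0 <= C by rewrite divr_ge0 ?sqr_ge0.
(* The first bound lets [mu * th] absorb the quadratic term; the second makes
   [(1 + mu) (1 - mu n th)] exceed 1. *)
pose mu := Num.min ((th - eta) / (1 + C)) ((1 - n%:R * th) / 2).
have mu0 : 0 < mu by rewrite lt_min !divr_gt0//; lra.
have mu1 : mu * (1 + C) <= th - eta.
  by rewrite -ler_pdivlMr; [rewrite ge_min lexx|lra].
have mu2 : mu <= (1 - n%:R * th) / 2 by rewrite ge_min lexx orbT.
have th0 : 0 < th by lra.
have nth0 : 0 < n%:R * th by exact: mulr_gt0.
exists mu, (1 + mu * th); split=> //.
- rewrite -mulrA -/C; have : mu * C <= th - eta by nra.
  nra.
- nra.
pose x := mu * th.
have x0 : 0 < x by exact: mulr_gt0.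
have nx : n%:R * x < 1.
  by rewrite /x mulrCA; move: (n%:R * th) nth nth0 mu2 => y; nra.
have x1 : x < 1.
  by apply: le_lt_trans nx; rewrite ler_peMl ?(ltW x0)// ler1n.
(* Bernoulli for [1 - x], combined with [(1 - x^2)^n <= 1], bounds [(1 + x)^n] by
   [1 / (1 - n x)]. *)
have bern : 1 - n%:R * x <= (1 - x) ^+ n.
  elim: (n) => [|m IH]; first by rewrite mul0r subr0 expr0.
  rewrite exprS; apply: (@le_trans _ _ ((1 - x) * (1 - m%:R * x))).
    by rewrite -natr1; have := ler0n R m; nra.
  by rewrite ler_pM2l// subr_gt0.
have prod_le : (1 + x) ^+ n * (1 - n%:R * x) <= 1.
  apply: (@le_trans _ _ ((1 + x) ^+ n * (1 - x) ^+ n)).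
    by rewrite ler_pM2l// exprn_gt0//; lra.
  rewrite -exprMn; apply: exprn_ile1; nra.
rewrite -/x -(ltr_pM2r (x := 1 - n%:R * x)); last by rewrite subr_gt0.
apply: le_lt_trans prod_le _.
have -> : n%:R * x = mu * (n%:R * th) by rewrite /x mulrCA.
by move: (n%:R * th) nth nth0 mu2 => y; nra.
Qed.

(** Stretching by [sqrt (1 + mu)] along [e], shifting along [e] and scaling by [1 / sqrt k] would
    give an enclosing pair whose [det^2] is larger by the factor [(1 + mu) / k^n > 1]. *)
Lemma loewner_slab A z e (a b : R) : (0 < n)%N -> A \in unitmx ->
  encloses A z ->
  (forall A' z', encloses A' z' -> \det A' ^+ 2 <= \det A ^+ 2) ->
  sqn e = 1 -> (forall x, K x -> - b <= dot (x *m A - z) e <= a) ->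
  1 <= n%:R * (a * b).
Proof.
move=> n0 uA KA Amax e1 Kab; rewrite leNgt; apply/negP => nab.
have [mu [k [mu0 kP k1 kn]]] := slab_improvement a b n0 nab.
have k0 : 0 < k by lra.
pose g := Num.sqrt (1 + mu) - 1.
have g2 : (1 + g) ^+ 2 = 1 + mu.
  by rewrite /g addrC subrK sqr_sqrtr//; lra.
have g1 : 0 < 1 + g by rewrite /g addrC subrK sqrtr_gt0; lra.
pose G : 'M[R]_n := 1%:M + (g *: e)^T *m e.
pose h := (Num.sqrt k)^-1.
have h0 : 0 < h by rewrite invr_gt0 sqrtr_gt0.
have h2 : h ^+ 2 = k^-1 by rewrite exprVn sqr_sqrtr// ltW.
(* [d] completes the square: [2 (1 + g) d] must be the linear coefficient [mu (b - a)] of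
   [mu (t - a) (t + b)]. *)
pose d := mu * (b - a) / (2 * (1 + g)).
have yG (y : 'rV[R]_n) : y *m G = y + (g * dot y e) *: e.
  rewrite mulmxDr mulmx1 mulmxA; congr (_ + _).
  rewrite [y *m _]mx11_scalar mul_scalar_mx -/(dot y (g *: e)) dotZr.
  by [].
have /Amax : encloses (h *: (A *m G)) (h *: (z *m G - d *: e)).
  move=> x Kx; have := KA _ Kx; have := Kab _ Kx; set y := x *m A - z => yab y1.
  have -> : x *m (h *: (A *m G)) - h *: (z *m G - d *: e) =
     h *: (y + (g * dot y e + d) *: e).
    rewrite -scalemxAr -scalerBr opprB addrCA addrC mulmxA -mulmxBl yG -/y.
    by rewrite -addrA -scalerDl.
  rewrite sqnZ h2 mulrC ler_pdivrMr// mul1r; apply: le_trans kP.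
  rewrite sqnD dotZr sqnZ e1 mulr1; set t := dot y e in yab *.
  have E1 : 2 * ((g * t + d) * t) + (g * t + d) ^+ 2 =
     ((1 + g) ^+ 2 - 1) * t ^+ 2 + 2 * (1 + g) * d * t + d ^+ 2 by ring.
  have gd : 2 * (1 + g) * d = mu * (b - a) by rewrite /d; field; rewrite gt_eqF.
  have d2 : d ^+ 2 <= mu ^+ 2 * (b - a) ^+ 2 / 4.
    rewrite /d expr_div_n exprMn exprMn g2 ler_pdivrMr; last by lra.
    have : 0 <= mu ^+ 2 * (b - a) ^+ 2 by rewrite -exprMn sqr_ge0.
    move: (mu ^+ 2 * (b - a) ^+ 2) => q; nra.
  rewrite -addrA E1 g2 gd; move/andP: yab => [yb ya].
  have : mu * ((t - a) * (t + b)) <= 0 by rewrite pmulr_rle0//; nra.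
  move: (mu ^+ 2 * (b - a) ^+ 2 / 4) (d ^+ 2) d2 => q p; nra.
apply/negP; rewrite -ltNge detZ det_mulmx exprMn exprMn.
have dA : 0 < \det A ^+ 2.
  by rewrite lt_neqAle eq_sym sqrf_eq0 sqr_ge0 andbT -unitfE -unitmxE.
rewrite det_rank_one -/(dot e (g *: e)) dotZr -/(sqn e) e1 mulr1 g2.
rewrite -exprM mulnC exprM h2 exprVn mulrCA ltr_pMr//.
by rewrite mulrC ltr_pdivlMr ?exprn_gt0// mul1r.
Qed.

(** The normal is [y - p] with [p] the point of [K] nearest to [y]: if [x - p] had positive product
    with it, moving from [p] towards [x] would come closer to [y]. *)
Lemma separation y : ~ K y ->
  exists g h, (forall x, K x -> dot x g <= h) /\ h < dot y g.
Proof.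
have [cK _ [k /interior_subset Kk]] := hK.
move=> nKy.
have fc : continuous (fun x : 'rV[R]_n => sqn (x - y)).
  have c1 : continuous (fun x : 'rV[R]_n => x - y).
    by move=> x; apply: continuousB; [exact: cvg_id|exact: cst_continuous].
  exact: continuous_dot.
have [|p /set_mem Kp pmin] := compact_EVT_min _ cK (continuous_subspaceT fc).
  by exists k.
have q0 : 0 < sqn (y - p).
  by rewrite sqn_gt0 subr_eq0; apply/eqP => yp; apply: nKy; rewrite yp.
exists (y - p), (dot p (y - p)); split; last first.
  by rewrite -subr_gt0 -dotNl -dotDl.
move=> x Kx; rewrite -subr_le0 -dotNl -dotDl leNgt; apply/negP => v0.
set v := dot (x - p) (y - p) in v0.
have key t : 0 <= t -> t <= 1 -> 0 <= - (2 * t * v) + t ^+ 2 * sqn (x - p).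
  move=> t0 t1;
    have := pmin _ (mem_set (convex_body_mix _ hK _ _ _ Kx Kp t0 t1)).
  have -> : t *: x + (1 - t) *: p - y = t *: (x - p) - (y - p).
    by apply/rowP => i; rewrite !mxE; ring.
  rewrite -(sqnN (p - y)) opprB (sqnD (t *: _)) sqnN dotNr dotZl sqnZ -/v; lra.
have w0 := sqn_ge0 (x - p); set w := sqn _ in key w0.
have D0 : 0 < v + w by lra.
(* This parameter lies in [[0, 1]] and makes the quadratic in [key] negative. *)
have := key (v / (v + w)); rewrite divr_ge0 ?(ltW v0) ?(ltW D0)// => /(_ isT).
rewrite ler_pdivrMr// mul1r lerDl w0 => /(_ isT).
have -> : - (2 * (v / (v + w)) * v) + (v / (v + w)) ^+ 2 * w =
   - (v ^+ 2 * (2 * v + w)) / (v + w) ^+ 2 by field; rewrite gt_eqF.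
rewrite mulNr oppr_ge0 leNgt divr_gt0 ?exprn_gt0// mulr_gt0 ?exprn_gt0//; lra.
Qed.

Lemma separation_in_frame A y : A \in unitmx -> ~ K y ->
  exists e a, [/\ sqn e = 1, forall x, K x -> dot (x *m A) e <= a &
    a < dot (y *m A) e].
Proof.
move=> uA /separation[g [h [Kg yg]]].
pose e0 := g *m (invmx A)^T.
have e0E x : dot (x *m A) e0 = dot x g.
  by rewrite dot_mulmxl /e0 -mulmxA -trmx_mul mulmxV// trmx1 mulmx1.
(* If [e0] vanished, [y] and any point of [K] would both have product 0 with [g], against strict
   separation. *)
have [k k0 k1] : exists2 k, 0 < k & sqn (k *: e0) = 1.
  apply: sqn_normalize; apply/eqP => e00.
  have [_ _ [x /interior_subset /Kg]] := hK.
  rewrite -e0E; move: yg; rewrite -e0E e00 /dot trmx0 !mulmx0 mxE; lra.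
exists (k *: e0), (k * h); split=> //.
  by move=> x Kx; rewrite dotZr e0E ler_pM2l// Kg.
by rewrite dotZr e0E ltr_pM2l.
Qed.

End Loewner.

(** * Bounds and the equality case *)

Section Bounds.
Context {R : realType} {n : nat} (K : set 'rV[R]_n).
Context (hK : convex_body K) (hn : (0 < n)%N).

Lemma loewner_inner_ball : exists A c, [/\ A \in unitmx,
  forall x, K x -> sqn ((x - c) *m A) <= 1 &
  forall x, sqn ((x - c) *m A) <= n%:R^-1 ^+ 2 -> K x].
Proof.
have [A [z [uA KA Amax]]] := exists_loewner K hK.
have N0 : 0 < n%:R :> R by rewrite ltr0n.
have cA x : (x - z *m invmx A) *m A = x *m A - z by rewrite mulmxBl mulmxKV.
exists A, (z *m invmx A); split=> // x; rewrite cA; first exact: KA.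
move=> xz; apply: contrapT => /(separation_in_frame K hK A x uA).
move=> [e [a [e1 Ka xa]]].
(* The lower bound comes from the enclosing unit ball alone; the upper one will be below [1/n],
   contradicting [loewner_slab]. *)
have Kab y : K y -> - 1 <= dot (y *m A - z) e <= a - dot z e.
  move=> Ky; rewrite {2}dotDl dotNl lerB ?Ka// andbT lerNl -dotNl.
  by apply: dot_le; rewrite // sqnN expr1n; exact: KA.
have := loewner_slab K A z e _ _ hn uA KA Amax e1 Kab.
rewrite mulr1 leNgt => /negP; apply.
have : dot (x *m A - z) e <= n%:R^-1 by apply: dot_le; rewrite ?invr_ge0 ?ler0n.
rewrite dotDl dotNl -(ler_pM2l N0) mulfV ?gt_eqF// => H.
by apply: lt_le_trans H; rewrite ltr_pM2l// ltrD2r.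
Qed.

Lemma chirality_le_dim j : (j <= n)%N -> chirality j K <= n%:R.
Proof.
move=> jn; have [A [c [_ KA AK]]] := loewner_inner_ball.
have [P jP PA] := exists_ortho_proj_preserves j A jn.
apply: (chirality_le_fits K hK hn j P) => //; first by rewrite ltr0n.
by apply: (fits_of_ellipsoid K A _ c c) => //; rewrite ltr0n.
Qed.

Lemma loewner_inner_ball_asymmetry (s : R) (t : 'rV[R]_n) : 0 < s ->
  (forall x, K x -> exists2 y, K y & - x = s *: y + t) ->
  exists A c d, [/\ A \in unitmx,
  forall x, K x -> sqn ((x - d) *m A) <= 1 &
  forall x, sqn ((x - c) *m A) <= (Num.sqrt (s * n%:R))^-1 ^+ 2 -> K x].
Proof.
move=> s0 Ks; have [A [z [uA KA Amax]]] := exists_loewner K hK.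
have N0 : 0 < n%:R :> R by rewrite ltr0n.
have dA x u : (x - u *m invmx A) *m A = x *m A - u by rewrite mulmxBl mulmxKV.
(* [tau = <r, e>] is the offset in the lower bound that the inclusion of [-K] forces. As the bound
   on [a] is centred at [- tau / (2 s)], the inner centre is [z - r / (2 s)]. *)
pose r := t *m A + (s + 1) *: z.
exists A, ((z - (2 * s)^-1 *: r) *m invmx A), (z *m invmx A).
split=> // x; rewrite dA; first exact: KA.
rewrite exprVn sqr_sqrtr; last by rewrite ltW// mulr_gt0.
move=> xr; apply: contrapT => /(separation_in_frame K hK A x uA).
move=> [e [a0 [e1 Ka xa]]].
pose a : R := a0 - dot z e; pose tau : R := dot r e.
have Kab y : K y -> - (s * a + tau) <= dot (y *m A - z) e <= a.
  move=> Ky; rewrite dotDl dotNl lerB ?Ka// andbT.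
  have [y' Ky' yE] := Ks y Ky.
  have -> : dot (y *m A) e = - (s * dot (y' *m A) e + dot (t *m A) e).
    by rewrite -(opprK y) yE mulNmx mulmxDl -scalemxAl dotNl dotDl dotZl.
  have := Ka _ Ky'; rewrite -(ler_pM2l s0).
  by rewrite /a /tau /r dotDl dotZl; lra.
have := loewner_slab K A z e _ _ hn uA KA Amax e1 Kab.
have [_ _ [k /interior_subset Kk]] := hK.
have wid : 0 <= a + (s * a + tau) by have := Kab _ Kk; lra.
set b : R := s * a + tau in wid * => nab.
have ab0 : 0 < a * b by rewrite -(pmulr_rgt0 _ N0); lra.
(* The product [a b] is positive and the width [a + b] is nonnegative. *)
have a_gt0 : 0 < a by nra.
have b_gt0 : 0 < b by nra.
(* Up to the factor [2 s], [q] is the signed distance of the separating hyperplane from the new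
   centre, and [q^2 = 4 s a b + tau^2]. *)
pose q : R := 2 * s * a + tau.
have q0 : 0 < q.
  have sa0 : 0 < s * a by exact: mulr_gt0.
  have -> : q = s * a + b by rewrite /q /b; ring.
  exact: addr_gt0.
have q_lt : q < 2 * s * dot (x *m A - (z - (2 * s)^-1 *: r)) e.
  rewrite opprB addrCA addrC dotDl dotZl dotDl dotNl -/tau.
  have -> : 2 * s * (dot (x *m A) e - dot z e + (2 * s)^-1 * tau) =
     2 * s * (dot (x *m A) e - dot z e) + tau by field; rewrite gt_eqF.
  rewrite /q /a ltrD2r ltr_pM2l ?mulr_gt0//; lra.
have := cauchy_schwarz (x *m A - (z - (2 * s)^-1 *: r)) e.
rewrite e1 mulr1 => /le_trans/(_ xr); set D := dot _ e in q_lt * => D2.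
have q2 : q ^+ 2 < (2 * s * D) ^+ 2.
  by rewrite ltr_pXn2r// nnegrE ltW//; exact: lt_trans q_lt.
have qE : q ^+ 2 = 4 * s * (a * b) + tau ^+ 2 by rewrite /q /b; ring.
have {}D2 : n%:R * (s * D ^+ 2) <= 1.
  by move: D2;
    rewrite -(ler_pM2l (mulr_gt0 s0 N0)) mulfV ?gt_eqF ?mulr_gt0// mulrAC mulrC.
have ab_lt : a * b < s * D ^+ 2.
  rewrite -(ltr_pM2l s0).
  by move: q2 (sqr_ge0 tau); rewrite qE !exprMn; lra.
by move: ab_lt; rewrite -(ltr_pM2l N0); lra.
Qed.

Lemma chirality_le_asymmetry j (s : R) (t : 'rV[R]_n) : (j <= n)%N -> 0 < s ->
  (forall x, K x -> exists2 y, K y & - x = s *: y + t) ->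
  chirality j K <= Num.sqrt (s * n%:R).
Proof.
move=> jn s0 Ks.
have [A [c [d [_ KA AK]]]] := loewner_inner_ball_asymmetry s t s0 Ks.
have [P jP PA] := exists_ortho_proj_preserves j A jn.
have l0 : 0 < Num.sqrt (s * n%:R) by rewrite sqrtr_gt0 mulr_gt0// ltr0n.
apply: (chirality_le_fits K hK hn j P) => //.
exact: (fits_of_ellipsoid K A _ c d).
Qed.

Lemma sqrt_mul_le_half (s N : R) : 0 < s -> 0 <= N ->
  Num.sqrt (s * N) <= (s + 1) / 2 * Num.sqrt N.
Proof.
move=> s0 N0; rewrite (sqrtrM _ (ltW s0)); apply: ler_wpM2r;
  first exact: sqrtr_ge0.
by have := sqr_ge0 (Num.sqrt s - 1); have := sqr_sqrtr (ltW s0); nra.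
Qed.

Lemma chirality_le_sqrt j : (j <= n)%N ->
  chirality j K <= (chirality 0 K + 1) / 2 * Num.sqrt n%:R.
Proof.
move=> jn; apply/ler_addgt0Pr => eps eps0.
have N0 : 0 < Num.sqrt n%:R :> R by rewrite sqrtr_gt0 ltr0n.
(* The excess over the infimum is chosen to raise the final bound by exactly [eps]. *)
pose s1 := chirality 0 K + 2 * eps / Num.sqrt n%:R.
have s1P : chirality 0 K < s1 by rewrite ltrDl divr_gt0// mulr_gt0.
have [P [s [jP /andP[s0 ss1] [w wK]]]] :=
  chirality_lt_fits K hK 0 s1 (leq0n n) s1P.
(* Reflection in a point has linear part [-1], so [fits] becomes an inclusion of [-K] in a translate
   of [s K]. *)
have P0 : P = 0 by apply/eqP; rewrite -mxrank_eq0 (ortho_proj_rank 0 P jP).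
apply: (@le_trans _ _ (Num.sqrt (s * n%:R))).
  apply: (chirality_le_asymmetry j s (- (s *: w))) => // x Kx.
  exists (s^-1 *: (x *m (2 *: P - 1%:M)) + w); first exact: wK.
  rewrite P0 scaler0 sub0r mulmxN mulmx1 scalerDr scalerA mulfV ?gt_eqF//.
  by rewrite scale1r addrK.
apply: le_trans (sqrt_mul_le_half _ _ s0 (ler0n _ _)) _.
have -> : (chirality 0 K + 1) / 2 * Num.sqrt n%:R + eps =
  (s1 + 1) / 2 * Num.sqrt n%:R by rewrite /s1; field; rewrite gt_eqF.
by rewrite ler_pM2r//; lra.
Qed.

(** The ratio is replaced by its inverse [m], which ranges over the compact [[0, 1]]; [m] is then
    maximized over triples whose map sends [K] into itself. *)
Lemma chirality_attained j : (j <= n)%N -> exists P m w,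
  [/\ ortho_proj j P, 0 <= m <= 1, 1 <= m * chirality j K &
     forall x, K x -> K (m *: (x *m (2 *: P - 1%:M)) + w)].
Proof.
move=> jn; have [cK _ [k /interior_subset Kk]] := hK.
have [r r0 rK] := compact_sqn_le _ K cK.
pose T := ('M[R]_n * 'rV[R]_n * R)%type.
(* The bound [2 * r] holds because [w] is a difference of two vectors of norm at most [r]. *)
pose C := [set P : 'M[R]_n | ortho_proj j P] `*`
  [set w : 'rV[R]_n | forall i l, `|w i l| <= 2 * r] `*` `[(0 : R), 1]%classic.
pose G x (q : T) := q.2 *: (x *m (2 *: q.1.1 - 1%:M)) + q.1.2.
have cC : compact C.
  apply: compact_setX; last exact: segment_compact.
  apply: compact_setX; first exact: compact_ortho_proj.
  apply: (mx_bounded_closed_compact _ _ _ (2 * r)) => //.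
  exact: closed_entries_le.
have cG x : continuous (G x).
  have c1 : continuous (fun q : T => q.1.1).
    by move=> q; apply: (@continuous_comp _ _ _ fst fst); exact: cvg_fst.
  have c2 : continuous (fun q : T => q.1.2).
    by move=> q; apply: (@continuous_comp _ _ _ fst snd);
      [exact: cvg_fst|exact: cvg_snd].
  apply: continuous_addmx c2; apply: continuous_scalemx => [q|];
    first exact: cvg_snd.
  apply: continuous_mulmx => [q|]; first exact: cst_continuous.
  apply: continuous_submx => [|q]; last exact: cst_continuous.
  by apply: (continuous_scalemx _ _ _ (fun=> 2)) => // q; exact: cst_continuous.
pose X := C `&` [set q | forall x, K x -> K (G x q)].
have cX : compact X.
  apply: compact_closedI => //.
  apply: closed_forall => x _; apply: (preimage_closed (f := G x)) => [q _|].
    exact: cG.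
  exact: compact_closed (@norm_hausdorff _ _) cK.
have inX P l w : ortho_proj j P -> 1 <= l ->
    (forall x, K x -> K (l^-1 *: (x *m (2 *: P - 1%:M)) + w)) -> X (P, w, l^-1).
  move=> jP l1 wK; have l0 : 0 < l by lra.
  have lV : 0 <= l^-1 <= 1 by rewrite invr_ge0 invf_le1// ltW.
  split; last by [].
  split; last by rewrite /= in_itv.
  split=> //= i m; rewrite (ord1 i); apply: entry_le_sqn; first by lra.
  set u := l^-1 *: (k *m (2 *: P - 1%:M)).
  have -> : w = (u + w) - u by rewrite addrC addKr.
  have q1 : sqn (u + w) <= r ^+ 2 by apply: rK; exact: wK.
  have q2 : sqn u <= r ^+ 2.
    rewrite /u sqnZ (ortho_proj_isometry j)//; apply: le_trans (rK _ Kk).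
    by move/andP: lV => [? ?]; rewrite ler_piMl ?sqn_ge0// exprn_ile1.
  move: (u + w) q1 => p q1.
  by have := sqn_ge0 (p + u); rewrite !sqnD sqnN dotNr; nra.
have fits_inX c : chirality j K < c -> exists2 q, X q & c^-1 < q.2 .
  move=> /(chirality_lt_fits K hK j c jn)[P [l [jP /andP[l0 lc] Fl]]].
  have l1 := fits_ge1 K hK hn _ l l0 (ortho_proj_isometry j P jP) Fl.
  have [w wK] := Fl; exists (P, w, l^-1); first exact: inX.
  by rewrite /= ltf_pV2// posrE; lra.
have chi1 := chirality_ge1 K hK hn j jn.
have [|[[P w] m] /set_mem Xq qmax] := compact_EVT_max _ cX
  (continuous_subspaceT (fun _ => cvg_snd) : {within X, continuous (fun q : T
    => q.2)}).
  by have [|q Xq _] := fits_inX (chirality j K + 1); [rewrite ltrDl|exists q].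
have [[[jP _]]] := Xq; rewrite /= in_itv/= => m01 mK.
exists P, m, w; split=> //.
rewrite leNgt; apply/negP => mlt.
(* [c^-1] is the midpoint of [m] and the inverse chirality, so [c] exceeds the chirality while
   [m <= c^-1]. *)
pose c := 2 * chirality j K / (1 + m * chirality j K).
have chi0 : 0 < chirality j K by lra.
have p0 : 0 < 1 + m * chirality j K.
  by case/andP: m01 => m0 _; rewrite ltr_pwDl// mulr_ge0// ltW.
have [q /mem_set/qmax/= qm] : exists2 q, X q & c^-1 < q.2.
  apply: fits_inX; rewrite /c ltr_pdivlMr// mulrC ltr_pM2r//; lra.
rewrite ltNge => /negP; apply; apply: le_trans qm _.
rewrite /c invf_div ler_pdivlMr ?mulr_gt0//; lra.
Qed.

Lemma reflection_symmetric_of_chirality1 j : (j <= n)%N -> chirality j K = 1 ->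
  exists2 U : set 'rV[R]_n, affine_subspace j U & K = reflection U @` K.
Proof.
move=> jn chi1; have [P [m [w [jP /andP[m0 m1]]]]] := chirality_attained j jn.
rewrite chi1 mulr1 => m1'; have -> : m = 1 by apply/eqP; rewrite eq_le m1.
have FF := ortho_proj_reflectionK j P jP.
have refl p x := reflection_ortho_proj j p P x jP.
set F := 2 *: P - 1%:M in FF refl * => wK.
have {}wK x : K x -> K (x *m F + w) by move=> /wK; rewrite scale1r.
have [cK _ [k /interior_subset Kk]] := hK.
(* Applying [x |-> xF + w] twice translates the bounded set [K] into itself. *)
have v0 : w *m F + w = 0.
  set v := w *m F + w.
  have dc : continuous (fun x : 'rV[R]_n => dot x v).
    apply: continuous_dot => x; [exact: cvg_id|exact: cst_continuous].
  have [|x /set_mem Kx xmax] := compact_EVT_max _ cK (continuous_subspaceT dc).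
    by exists k.
  have := xmax _ (mem_set (wK _ (wK _ Kx))).
  rewrite mulmxDl -mulmxA FF mulmx1 -addrA -/v dotDl gerDl -/(sqn v) => v_le0.
  by apply/eqP; rewrite -sqn_eq0 eq_le v_le0 sqn_ge0.
(* Since [w F = - w], the point [w / 2] is fixed by [x |-> x F + w]. *)
pose p := 2^-1 *: w.
have wF : w *m F = - w by apply/eqP; rewrite -addr_eq0 v0.
have reflE x : reflection [set p + v *m P | v in setT] x = x *m F + w.
  rewrite refl mulmxBl /p -scalemxAl wF.
  by move: (x *m F) => y; apply/rowP => i; rewrite !mxE; field.
exists [set p + v *m P | v in setT]; first by apply/affine_subspaceP;
  exists p, P.
(* An involution mapping [K] into itself maps it onto itself. *)
apply/seteqP; split=> [x Kx|_ [x Kx <-]]; last by rewrite reflE; exact: wK.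
exists (x *m F + w); first exact: wK.
by rewrite reflE mulmxDl -mulmxA FF mulmx1 -addrA v0 addr0.
Qed.

Lemma chirality1_of_reflection_symmetric j U : (j <= n)%N ->
  affine_subspace j U -> K = reflection U @` K -> chirality j K = 1.
Proof.
move=> jn /affine_subspaceP[p [P [jP ->]]] KE; apply/eqP; rewrite eq_le.
rewrite (chirality_ge1 K hK hn j jn) andbT.
apply: (chirality_le_fits K hK hn j P) => //.
exists (p - p *m (2 *: P - 1%:M)) => x Kx.
rewrite invr1 scale1r addrCA -mulmxBl -(reflection_ortho_proj j)//.
by rewrite KE; exists x.
Qed.

End Bounds.

Theorem theorem1p1 (R : realType) (n : nat) (hn : (0 < n)%N)
    (K : set 'rV[R]_n) (hK : convex_body K) (j : nat) (hj : (j <= n)%N) :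
  1 <= chirality j K <=
      Num.min n%:R ((chirality 0 K + 1) / 2 * Num.sqrt n%:R) /\
  (chirality j K = 1 <->
     exists2 U : set 'rV[R]_n, affine_subspace j U & K = reflection U @` K).
Proof.
split; first by rewrite chirality_ge1// le_min chirality_le_dim//
  chirality_le_sqrt.
split; first exact: reflection_symmetric_of_chirality1.
by move=> [U jU KU]; apply: (chirality1_of_reflection_symmetric K hK hn j U).
Qed.
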